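(* Let $q$ be an odd prime power and let $V$ be a finite-dimensional vector space over $\mathbb{F}_q$ equipped with a nondegenerate symmetric bilinear form $\langle\cdot,\cdot\rangle$. Choose a matrix $G\in\mathbb{F}_q^{n\times n}$ and a basic submatrix $G_b$ of $G$. Then $G$ is the Gram matrix of a frame for $V$ if and only if the following hold: (i) $G=G^\top$; (ii) $\operatorname{rank} G=\dim V$; (iii) $(\det G_b)\,\mathbb{F}_q^{\times 2}=\operatorname{discr}(V)$. Consequently, every symmetric matrix $G\in\mathbb{F}_q^{n\times n}$ occurs as the Gram matrix of a frame for a quadratic space over $\mathbb{F}_q$, namely one in dimension $\operatorname{rank} G$ whose discriminant matches the determinant of a basic submatrix of $G$.
   Context: A quadratic space over $\mathbb{F}_q$ ($q$ odd) is a finite-dimensional $\mathbb{F}_q$-vector space with a nondegenerate symmetric bilinear form. $\mathbb{F}_q^{\times 2}$ is the subgroup of nonzero squares in $\mathbb{F}_q^\times$. The discriminant $\operatorname{discr}(V)\in\mathbb{F}_q^\times/\mathbb{F}_q^{\times 2}$ of a quadratic space is $(\det M)\,\mathbb{F}_q^{\times 2}$, where $M=[\langle e_i,e_j\rangle]$ for any basis $e_1,\dots,e_d$ of $V$ (independent of the basis). A frame for $V$ with $n$ vectors is a sequence $\Phi=\{\varphi_j\}_{j=1}^n$ in $V$ that spans $V$; its Gram matrix is $[\langle\varphi_i,\varphi_j\rangle]_{i,j=1}^n$. Basic submatrix: given a square matrix $M=[M_{ij}]_{i,j\in[n]}$ with columns $m_1,\dots,m_n$, select an index set $I\subseteq[n]=\{1,\dots,n\}$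 such that $\{m_j\}_{j\in I}$ is a basis of $\operatorname{Im} M$ (the column space); then $M_b=[M_{ij}]_{i,j\in I}$ is called a basic submatrix of $M$. *)

(* Defs.v *)
From HB Require Import structures.
From mathcomp Require Import all_boot all_order all_algebra.
Set Implicit Arguments.
Unset Strict Implicit.
Unset Printing Implicit Defensive.
Import GRing.Theory.
Local Open Scope ring_scope.

Section QuadraticSpaces.
Variables (F : finFieldType) (V : vectType F) (B : {symmetric V}).

Definition nz_squares : {set F} := [set x ^+ 2 | x in [set x : F | x != 0]].

(* The coset a F^x2; the elements of F^x / F^x2 are these sets for a != 0, *)
(* and sq_coset 0 = [set 0] is none of them.                               *)
Definition sq_coset (a : F) : {set F} := [set a * s | s in nz_squares].

Definition gram n (phi : n.-tuple V) : 'M[F]_n :=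
  \matrix_(i, j) B (tnth phi i) (tnth phi j).

(* Computed from a particular basis; see discr_basis for independence. *)
Definition discr : {set F} := sq_coset (\det (gram (vbasis {:V}))).

Definition is_frame n (phi : n.-tuple V) : Prop := <<phi>>%VS = {:V}%VS.

Lemma sq_cosetM a s : s != 0 -> sq_coset (s ^+ 2 * a) = sq_coset a.
Proof.
move=> s0; apply/setP=> x; apply/imsetP/imsetP=> -[y /imsetP[t]].
  rewrite inE => t0 -> ->; exists ((s * t) ^+ 2).
    by apply: imset_f; rewrite inE mulf_neq0.
  by rewrite exprMn -mulrA [RHS]mulrCA.
rewrite inE => t0 -> ->; exists ((s^-1 * t) ^+ 2).
  by apply: imset_f; rewrite inE mulf_neq0 ?invr_eq0.
by rewrite exprMn exprVn [s ^+ 2 * a]mulrC -mulrA mulVKf // expf_neq0.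
Qed.

Lemma gram_coord m n (phi : m.-tuple V) (b : n.-tuple V) :
  basis_of {:V} b ->
  let C := \matrix_(i, k) coord b k (tnth phi i) in
  gram phi = C *m gram b *m C^T.
Proof.
move=> bP C; apply/matrixP=> i j; rewrite [LHS]mxE [RHS]mxE.
have E v : v = \sum_k coord b k v *: tnth b k.
  rewrite {1}(coord_basis bP (memvf v)).
  by apply: eq_bigr => k _; rewrite (tnth_nth 0).
set u := tnth phi i; set w := tnth phi j.
rewrite {1}[w]E linear_sumr; apply: eq_bigr => k _.
rewrite linearZr /= !mxE mulrC; congr (_ * _).
rewrite {1}[u]E linear_sumlz; apply: eq_bigr => l _.
by rewrite linearZl_LR /= !mxE.
Qed.

Lemma discr_basis n (b : n.-tuple V) :
  basis_of {:V} b -> discr = sq_coset (\det (gram b)).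
Proof.
move=> bP; have En : \dim {:V} = n.
  by rewrite (size_basis bP).
rewrite /discr; move: (vbasis _) (vbasisP {:V}); rewrite {}En => e eP.
rewrite (gram_coord e bP) !det_mulmx det_tr mulrAC -expr2 sq_cosetM //.
rewrite -unitfE -unitmxE; set C := (X in X \in _).
pose D := \matrix_(i, k) coord e k (tnth b i).
suff : C *m D = 1%:M by case/mulmx1_unit.
apply/matrixP=> i j; rewrite !mxE.
transitivity (coord e j (tnth e i)); last first.
  by rewrite (tnth_nth 0) coord_free ?(basis_free eP) // eq_sym.
rewrite (coord_basis bP (memvf (tnth e i))) linear_sum /=.
by apply: eq_bigr => k _; rewrite !mxE linearZ (tnth_nth 0 b).
Qed.

End QuadraticSpaces.

Section BasicSubmatrix.
Variables (F : fieldType) (n : nat) (M : 'M[F]_n).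

Definition colspace : {vspace 'cV[F]_n} := <<[seq col j M | j : 'I_n]>>%VS.

(* The columns are taken as a family: repeated columns are never a basis. *)
Definition basic_index (I : {set 'I_n}) : bool :=
  basis_of colspace [seq col j M | j in I].

Definition basic_submx (I : {set 'I_n}) : 'M[F]_#|I| :=
  mxsub enum_val enum_val M.

End BasicSubmatrix.

(* Main.v *)
(** If [G] is symmetric and the columns indexed by [I] form a basis of its
    column space, then [G = A^T G_b A] with [G_b] invertible. For a frame with
    Gram matrix [G], the vectors indexed by [I] form a basis of [V] by
    nondegeneracy, and [G_b] is its Gram matrix. Conversely, over a finite field
    of odd order every binary form [a x^2 + c y^2] with [a, c != 0] represents
    1, so a nondegenerate symmetric matrix is congruent to [diag(1, .., 1, d)],
    and its congruence class is determined by its size and discriminant. Hence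
    a basis [b] of [V] satisfies [G_b = P (gram b) P^T], and [A^T P] gives the
    coordinates of a frame. *)

Require Import Defs.
From mathcomp Require Import all_boot all_order all_algebra.
From mathcomp Require Import finfield ring.
Set Implicit Arguments.
Unset Strict Implicit.
Unset Printing Implicit Defensive.
Import GRing.Theory.
Local Open Scope ring_scope.

(** * Squares and values of forms over a finite field of odd order *)

Section OddFiniteField.
Variables (F : finFieldType) (oddF : odd #|F|).

(** In characteristic 2 the order of [F] is a power of 2, odd only if it is 1. *)
Lemma odd_card_two_neq0 : 2%:R != 0 :> F.
Proof.
apply/eqP => two0.
have char2 : 2%N \in [pchar F] by apply/andP; split => //; apply/eqP.
have := oddF; rewrite (card_pprimeChar char2) oddX orbF => /eqP d0.
have := finRing_gt1 F; rewrite (card_pprimeChar char2).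
by rewrite d0.
Qed.

(** Each fibre of squaring lies in some [{x, -x}], which gives the weak inequality; it is strict
    because [#|F|] is odd. *)
Lemma card_squares : (#|F| < #|[set x ^+ 2 | x : F]|.*2)%N.
Proof.
suff le : (#|F| <= #|[set x ^+ 2 | x : F]|.*2)%N.
  rewrite ltn_neqAle le andbT; apply: contraL oddF => /eqP ->.
  by rewrite odd_double.
rewrite -muln2 -sum_nat_const -sum1_card.
rewrite (partition_big_imset (fun x : F => x ^+ 2)) /=.
apply: leq_sum => _ /imsetP[x _ ->]; rewrite sum1dep_card.
apply: leq_trans (_ : #|[set x; - x]| <= _)%N.
  by apply/subset_leq_card/subsetP => y; rewrite !inE eqf_sqr.
by rewrite cards2; case: eqP.
Qed.

(* Pigeonhole: [a x^2] and [1 - c y^2] each take more than #|F| / 2 values. *)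
Lemma binary_form_represents1 (a c : F) :
  a != 0 -> c != 0 -> exists x y, a * x ^+ 2 + c * y ^+ 2 = 1.
Proof.
move=> a0 c0; pose S := [set x ^+ 2 | x : F].
pose A := [set a * s | s in S]; pose C := [set 1 - c * s | s in S].
have cA : #|A| = #|S| by rewrite card_imset //; apply: mulfI.
have cC : #|C| = #|S|.
  by rewrite card_imset // => u v /(addrI _)/oppr_inj/(mulfI c0).
have /set0Pn[z] : A :&: C != set0.
  apply: contraTneq card_squares => AC0; rewrite -leqNgt -addnn.
  by rewrite -{1}cA -cC -cardsUI AC0 cards0 addn0 max_card.
rewrite inE => /andP[/imsetP[_ /imsetP[x _ ->] ->] /imsetP[_ /imsetP[y _ ->]]].
by move=> e; exists x, y; rewrite e subrK.
Qed.

(** Polarization: if [B v v] vanishes identically, then so does [2 B u v], and 2 is invertible. The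
    entries of [M] are values of [B] at unit vectors. *)
Lemma sym_form_neq0 n (M : 'M[F]_n) :
  M = M^T -> M != 0 -> exists v : 'rV_n, (v *m M *m v^T) 0 0 != 0.
Proof.
move=> symM M0; pose B (u v : 'rV_n) := (u *m M *m v^T) 0 0.
have BC u v : B u v = B v u.
  rewrite /B -(trmxK (v *m M *m u^T)) [in RHS]mxE.
  by rewrite !trmx_mul trmxK -symM mulmxA.
case: (pickP (fun v => B v v != 0)) => [v vP | isoB]; first by exists v.
case/eqP: M0; apply/matrixP=> i j.
pose e (k : 'I_n) : 'rV[F]_n := delta_mx 0 k.
have -> : M i j = B (e i) (e j).
  by rewrite /B -rowE trmx_delta -colE !mxE.
have B0 v : B v v = 0 by have /negbFE/eqP := isoB v.
have add00 (X Y : 'M[F]_1) : (X + Y) 0 0 = X 0 0 + Y 0 0 by rewrite mxE.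
have := B0 (e i + e j); rewrite /B linearD /= !(mulmxDl, mulmxDr) !add00.
rewrite -!/(B _ _) !B0 add0r addr0 (BC (e j)) -mulr2n -mulr_natl.
by move/eqP; rewrite mulf_eq0 (negPf odd_card_two_neq0) => /eqP->; rewrite mxE.
Qed.

End OddFiniteField.

(** * Orthogonal splitting and classification by the determinant *)

Lemma sym_split (F : fieldType) r (M : 'M[F]_(1 + r)) (v : 'rV_(1 + r)) a :
  M = M^T -> v *m M *m v^T = a%:M -> a != 0 ->
  exists Q D, [/\ Q \in unitmx, D = D^T & Q *m M *m Q^T = block_mx a%:M 0 0 D].
Proof.
move=> symM vM a0.
have v0 : v != 0.
  apply: contraNneq a0 => v0; move/matrixP: vM => /(_ 0 0).
  by rewrite v0 !mul0mx !mxE eqxx mulr1n => <-.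
pose U : 'rV[F]_(1 + r) := row_mx 1%:M 0.
(* Completes [v] to an invertible [g] with first row [v], so that [a] becomes the upper left entry
   of [N]. *)
have [|g gU] := @complete_unitmx _ _ _ U (col_mx v 0).
  rewrite mul_row_col mul1mx mul0mx addr0 !rank_rV v0.
  by rewrite row_mx_eq0 oner_eq0.
rewrite mul_row_col mul1mx mul0mx addr0 => vE.
pose N := g *m M *m g^T.
have symN : N = N^T by rewrite /N !trmx_mul trmxK -symM mulmxA.
have ulN : ulsubmx N = a%:M.
  rewrite -vM vE trmx_mul !mulmxA -(mulmxA U) -(mulmxA U) -/N -[N]submxK /U.
  rewrite mul_row_block tr_row_mx mul_row_col !(mul1mx, mul0mx, addr0).
  by rewrite trmx1 trmx0 mulmx1 mulmx0 addr0 block_mxKul.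
have dlN : (ursubmx N)^T = dlsubmx N by rewrite trmx_ursub -symN.
have drN : (drsubmx N)^T = drsubmx N by rewrite trmx_drsub -symN.
pose b := ursubmx N.
(* One step of symmetric elimination with pivot [a]; the remaining block is the Schur complement. *)
pose L := block_mx 1%:M 0 (- a^-1 *: b^T) (1%:M : 'M_r).
exists (L *m g), (drsubmx N - a^-1 *: (b^T *m b)); split.
- by rewrite unitmx_mul gU andbT unitmxE det_lblock !det1 mulr1 unitr1.
- rewrite [RHS]linearB /= drN; congr (_ - _).
  by rewrite [RHS]linearZ /= trmx_mul trmxK.
rewrite trmx_mul !mulmxA -(mulmxA L) -(mulmxA L) -/N.
rewrite -[N]submxK ulN -dlN -/b /L tr_block_mx !mulmx_block.
rewrite !(trmx0, trmx1, mul1mx, mul0mx, mulmx1, mulmx0, addr0, add0r).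
rewrite linearZ /= trmxK -!scalemxAl -!scalemxAr mul_scalar_mx mul_mx_scalar.
rewrite !scalerA !mulNr mulVf // !scaleN1r !addNr mul0mx scaler0 add0r.
by rewrite block_mxKdr addrC scaleNr.
Qed.

Section Classification.
Variables (F : finFieldType) (oddF : odd #|F|).

(** Splitting off any nonzero value [a] leaves a nonzero block with its own nonzero value [c]. The
    binary form with coefficients [a] and [c] represents 1, so a vector of value 1 exists and can be
    split off instead. *)
Lemma sym_unit_split1 r (M : 'M[F]_(1 + r.+1)) :
  M = M^T -> M \in unitmx ->
  exists Q D, [/\ Q \in unitmx, D = D^T & Q *m M *m Q^T = block_mx 1%:M 0 0 D].
Proof.
move=> symM uM.
have M0 : M != 0 by apply: contraTneq uM => ->; rewrite unitmxE det0 unitr0.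
have [v va] := sym_form_neq0 oddF symM M0.
have [Q [D [uQ symD QE]]] := sym_split symM (mx11_scalar _) va.
have uD : D \in unitmx.
  have : Q *m M *m Q^T \in unitmx by rewrite !unitmx_mul unitmx_tr uQ uM.
  by rewrite QE block_diag_mx_unit => /andP[].
have D0 : D != 0 by apply: contraTneq uD => ->; rewrite unitmxE det0 unitr0.
have [w wc] := sym_form_neq0 oddF symD D0.
have [x [y xy]] := binary_form_represents1 oddF va wc.
(* The vector with coordinates [x] and [y *: w] after the first splitting, carried back by [Q] to
   the coordinates of [M]. *)
apply: (@sym_split _ _ M (row_mx x%:M (y *: w) *m Q)); rewrite ?oner_neq0 //.
rewrite trmx_mul !mulmxA -(mulmxA _ Q M) -(mulmxA _ _ Q^T) QE.
rewrite mul_row_block tr_row_mx !(mulmx0, addr0, add0r) mul_row_col.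
rewrite tr_scalar_mx linearZ /= -scalemxAl -scalemxAl -scalemxAr.
rewrite (mx11_scalar (w *m D *m w^T)).
rewrite -!scalar_mxM !scale_scalar_mx -raddfD /=; congr (_%:M).
by rewrite -xy; ring.
Qed.

(** Induction on the size: a 1 is split off both matrices, and the determinants of the remaining
    blocks still differ by a nonzero square. In size one, [s] itself is the congruence. *)
Lemma congruent_of_det r (M N : 'M[F]_r) (s : F) :
  M = M^T -> N = N^T -> M \in unitmx -> N \in unitmx ->
  s != 0 -> \det M = s ^+ 2 * \det N ->
  exists P : 'M_r, M = P *m N *m P^T.
Proof.
elim: r M N s => [|[|r] IH] M N s symM symN uM uN s0 dMN.
- by exists 1%:M; rewrite !flatmx0.
- exists s%:M; rewrite tr_scalar_mx mul_scalar_mx mul_mx_scalar scalerA -expr2.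
  move: dMN; rewrite !det_mx11 => dMN.
  by rewrite [LHS]mx11_scalar dMN [in RHS](mx11_scalar N) scale_scalar_mx.
have [Q [D [uQ symD QE]]] := sym_unit_split1 symM uM.
have [R [E [uR symE RE]]] := sym_unit_split1 symN uN.
have uD : D \in unitmx.
  have : Q *m M *m Q^T \in unitmx by rewrite !unitmx_mul unitmx_tr uQ uM.
  by rewrite QE block_diag_mx_unit => /andP[].
have uE : E \in unitmx.
  have : R *m N *m R^T \in unitmx by rewrite !unitmx_mul unitmx_tr uR uN.
  by rewrite RE block_diag_mx_unit => /andP[].
have dQ : \det Q != 0 by rewrite -unitfE -unitmxE.
have dR : \det R != 0 by rewrite -unitfE -unitmxE.
have [P PE] : exists P, D = P *m E *m P^T.
  (* Congruence by [Q] multiplies the determinant by [(\det Q) ^+ 2], and likewise for [R]. *)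
  apply: (IH D E (\det Q * s / \det R)) => //.
    by rewrite !mulf_neq0 ?invr_eq0.
  have := congr1 determinant QE; rewrite det_ublock det1 mul1r => <-.
  have := congr1 determinant RE; rewrite det_ublock det1 mul1r => <-.
  by rewrite !det_mulmx !det_tr dMN; field.
pose T : 'M[F]_(1 + r.+1) := block_mx 1%:M 0 0 P.
have TE : Q *m M *m Q^T = T *m (R *m N *m R^T) *m T^T.
  rewrite QE RE tr_block_mx !mulmx_block.
  by rewrite !(trmx0, trmx1, mul1mx, mul0mx, mulmx1, mulmx0, addr0, add0r) -PE.
exists (invmx Q *m T *m R); rewrite !trmx_mul.
have -> : M = invmx Q *m (Q *m M *m Q^T) *m (invmx Q)^T.
  by rewrite !mulmxA mulVmx // mul1mx -mulmxA -trmx_mul mulVmx // trmx1 mulmx1.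
by rewrite TE !mulmxA.
Qed.

End Classification.

(** * Basic submatrices and the factorization through them *)

Section BasicSubmatrices.
Variables (F : fieldType) (n : nat).
Implicit Types (M : 'M[F]_n) (I : {set 'I_n}).

(** Matrix form of the two halves of being a basis: column [j] of [A] holds the coordinates of
    column [j] of [M] in the selected columns. *)
Lemma basic_indexP M I :
  basic_index M I ->
  (forall c : 'cV_#|I|, colsub enum_val M *m c = 0 -> c = 0) /\
  exists A, M = colsub (enum_val : 'I_#|I| -> 'I_n) M *m A.
Proof.
set X := [tuple col (enum_val i) M | i < #|I|].
have colX (c : 'cV_#|I|) : colsub enum_val M *m c = \sum_i c i 0 *: X`_i.
  apply/colP=> j; rewrite !mxE summxE; apply: eq_bigr => i _.
  by rewrite -tnth_nth tnth_mktuple !mxE mulrC.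
rewrite /basic_index.
have -> : [seq col j M | j in I] = X.
  apply: (@eq_from_nth _ 0); rewrite size_map -cardE ?size_tuple // => i ltI.
  pose k := Ordinal ltI; rewrite (nth_map (enum_val k)) -?cardE //.
  rewrite -[RHS](tnth_nth 0 X k) tnth_mktuple.
  by rewrite [in RHS](enum_val_nth (enum_val k)).
case/andP=> /eqP spanX /freeP freeX; split.
  move=> c; rewrite colX => /freeX c0; apply/colP=> i.
  by rewrite c0 mxE.
pose A := \matrix_(i, j) coord X i (col j M); exists A.
suff colMj j : col j M = colsub enum_val M *m col j A.
  apply/matrixP=> i j; have /colP/(_ i) := colMj j.
  rewrite [in X in _ = X -> _]colE mulmxA -colE.
  by rewrite [X in X = _ -> _]mxE [X in _ = X -> _]mxE.
rewrite colX.
have /coord_span {1}-> : col j M \in <<X>>%VS.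
  by rewrite spanX memv_span // image_f.
by apply: eq_bigr => i _; rewrite !mxE.
Qed.

(** Independence of the selected columns bounds [#|I|] above by the rank; the factorization of [M]
    through them bounds it below. *)
Lemma basic_index_card M I : basic_index M I -> #|I| = \rank M.
Proof.
case/basic_indexP=> freeS [A ME]; apply/eqP; rewrite eqn_leq; apply/andP; split.
  suff /eqP <- : row_free (colsub (enum_val : 'I_#|I| -> 'I_n) M)^T.
    by rewrite mxrank_tr -[M in colsub _ M]mulmx1 -mulmx_colsub mxrankM_maxl.
  apply: inj_row_free => v v0; apply: trmx_inj; rewrite trmx0; apply: freeS.
  by apply: trmx_inj; rewrite trmx_mul trmxK v0 trmx0.
by rewrite ME (leq_trans (mxrankM_maxl _ _)) // rank_leq_col.
Qed.

(** A largest free family of columns spans, since a column outside its span could be added to it. *)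
Lemma basic_index_exists M : exists I, basic_index M I.
Proof.
have [I freeI maxI] : exists2 I : {set 'I_n}, free [seq col j M | j in I] &
    forall J : {set 'I_n}, free [seq col j M | j in J] -> (#|J| <= #|I|)%N.
  pose P (I : {set 'I_n}) := free [seq col j M | j in I].
  have P0 : P set0 by rewrite /P /image_mem enum_set0 nil_free.
  by case: (arg_maxnP (fun I : {set 'I_n} => #|I|) P0) => I; exists I.
exists I; rewrite /basic_index /basis_of freeI andbT.
rewrite eqEsubv; apply/andP; split; apply/span_subvP=> v /mapP[j _ ->].
  by rewrite memv_span // image_f.
apply: contraT => jNspan.
have jNI : j \notin I.
  by apply: contra jNspan => jI; rewrite memv_span // image_f.
suff /maxI : free [seq col i M | i in j |: I] by rewrite cardsU1 jNI ltnn.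
have /perm_free -> : perm_eq [seq col i M | i in j |: I]
    (col j M :: [seq col i M | i in I]).
  rewrite -[X in perm_eq _ X]/(map (fun j => col j M) (j :: enum I)).
  apply/perm_map/uniq_perm; rewrite ?enum_uniq //= ?mem_enum ?jNI ?enum_uniq //.
  by move=> i; rewrite mem_enum !inE mem_enum.
by rewrite free_cons jNspan.
Qed.

(** Let [S] be the selected columns, so [M = S *m A]. Restricting this to the rows in [I] gives, by
    symmetry, that [S^T] is the basic submatrix times [A]; transposing yields [S]. *)
Lemma sym_basic_factor M I :
  M = M^T -> basic_index M I ->
  exists A, M = A^T *m basic_submx M I *m A.
Proof.
move=> symM /basic_indexP[_ [A ME]]; exists A.
have symb : (basic_submx M I)^T = basic_submx M I by rewrite trmx_mxsub -symM.
rewrite {1}ME; congr (_ *m A).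
rewrite {1}symM -trmx_mxsub -symb -trmx_mul; congr trmx.
rewrite {1}ME -mul_rowsub_mx; congr (_ *m _).
by apply/matrixP=> i j; rewrite !mxE.
Qed.

(** The factorization bounds the rank of [M], which is [#|I|], by that of the basic submatrix. *)
Lemma basic_submx_unit M I :
  M = M^T -> basic_index M I -> basic_submx M I \in unitmx.
Proof.
move=> symM bI; rewrite -row_full_unit /row_full eqn_leq rank_leq_col /=.
rewrite {1}(basic_index_card bI); have [A {1}->] := sym_basic_factor symM bI.
by rewrite (leq_trans (mxrankM_maxl _ _)) ?mxrankM_maxr.
Qed.

End BasicSubmatrices.

(** * Gram matrices of bases and frames *)

Section GramMatrices.
Variables (F : finFieldType) (V : vectType F) (B : {symmetric V}).

Lemma symmetricC u v : B u v = B v u.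
Proof. by rewrite hermC expr0 mul1r. Qed.

Lemma nondegenerateP :
  reflect (forall u, (forall v, B u v = 0) -> u = 0) (nondegenerate B).
Proof.
apply: (iffP eqP) => [rad0 u Bu0 | nd].
  apply/eqP; rewrite -memv0 -rad0; apply/mem_orthovP => v _; exact: Bu0.
apply/eqP; rewrite -subv0; apply/subvP => u /mem_orthovP Bu0.
by rewrite memv0; apply/eqP/nd => v; apply: Bu0; apply: memvf.
Qed.

Lemma gram_sym n (phi : n.-tuple V) : gram B phi = (gram B phi)^T.
Proof. by apply/matrixP=> i j; rewrite !mxE symmetricC. Qed.

Lemma form_span_eq0 (X : seq V) u :
  <<X>>%VS = {:V}%VS -> {in X, forall v, B u v = 0} -> forall v, B u v = 0.
Proof.
move=> spanX Xu0 v; have: v \in <<in_tuple X>>%VS by rewrite spanX memvf.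
move/coord_span=> ->; rewrite linear_sumr big1 // => i _.
by rewrite linearZr /= Xu0 ?mulr0 // mem_nth.
Qed.

(** A row in the left kernel gives the coordinates of a vector orthogonal to the basis, hence to all
    of [V]. *)
Lemma gram_unit n (b : n.-tuple V) :
  nondegenerate B -> basis_of {:V} b -> gram B b \in unitmx.
Proof.
move=> /nondegenerateP nd bP; rewrite -row_free_unit.
apply: inj_row_free => c c0; pose u := \sum_k c 0 k *: b`_k.
have u0 : u = 0.
  apply/nd/(form_span_eq0 (span_basis bP)) => _ /tnthP[j ->].
  have /rowP/(_ j) := c0; rewrite !mxE => <-.
  rewrite linear_sumlz; apply: eq_bigr => k _.
  by rewrite linearZl_LR /= mxE (tnth_nth 0 b k).
apply/rowP=> k; rewrite mxE -(coord_sum_free (c 0) k (basis_free bP)).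
by rewrite -/u u0 linear0.
Qed.

(** Linear relations among the frame vectors and among the columns of the Gram matrix are the same:
    a vector orthogonal to the whole frame is zero. *)
Lemma frame_basic_subframe n (phi : n.-tuple V) (I : {set 'I_n}) :
  nondegenerate B -> is_frame phi -> basic_index (gram B phi) I ->
  basis_of {:V} [tuple tnth phi (enum_val i) | i < #|I|].
Proof.
move=> /nondegenerateP nd spanphi /basic_indexP[freeS [A GE]].
set b := [tuple _ | _ < _].
have bE (k : 'I_#|I|) : b`_k = tnth phi (enum_val k).
  by rewrite -tnth_nth tnth_mktuple.
apply/andP; split.
  rewrite eqEsubv subvf -spanphi; apply/span_subvP=> _ /tnthP[j ->].
  (* The coefficients that express column [j] of the Gram matrix also express the vector [j] of the
     frame. *)
  suff -> : tnth phi j = \sum_k A k j *: b`_k.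
    apply: memv_suml => k _; rewrite memvZ // memv_span //.
    by rewrite mem_nth ?size_tuple.
  apply/eqP; rewrite -subr_eq0; apply/eqP/nd/(form_span_eq0 spanphi).
  move=> _ /tnthP[i ->]; have /matrixP/(_ i j) := GE; rewrite !mxE => e.
  rewrite linearBl /= symmetricC e linear_sumlz; apply/eqP; rewrite subr_eq0.
  apply/eqP/eq_bigr => k _.
  by rewrite linearZl_LR /= bE !mxE symmetricC mulrC.
apply/freeP=> c c0 k; have /colP/(_ k) : \col_i c i = 0 :> 'cV_#|I|.
  apply: freeS; apply/colP=> i; rewrite !mxE -[RHS](linear0l B (tnth phi i)).
  rewrite -{}c0 linear_sumlz; apply: eq_bigr => l _.
  by rewrite linearZl_LR /= bE !mxE symmetricC mulrC.
by rewrite !mxE.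
Qed.

Lemma gram_basic_subframe n (phi : n.-tuple V) (I : {set 'I_n}) :
  gram B [tuple tnth phi (enum_val i) | i < #|I|] = basic_submx (gram B phi) I.
Proof. by apply/matrixP=> i j; rewrite !mxE !tnth_mktuple. Qed.

(** A left inverse of [C] recovers the basis vectors from the combinations. *)
Lemma frame_comb n r (b : r.-tuple V) (C : 'M[F]_(n, r)) :
  basis_of {:V} b -> row_full C ->
  is_frame [tuple \sum_k C i k *: b`_k | i < n].
Proof.
move=> bP /row_fullP[D DC]; set phi := mktuple _.
apply/eqP; rewrite eqEsubv subvf /=.
rewrite -(span_basis bP); apply/span_subvP=> _ /tnthP[j ->].
suff -> : tnth b j = \sum_i D j i *: tnth phi i.
  by apply: memv_suml => i _; rewrite memvZ // memv_span // mem_tnth.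
under eq_bigr do rewrite tnth_mktuple scaler_sumr.
rewrite exchange_big /= (bigD1 j) //= [X in _ + X]big1 ?addr0 => [|k kj].
  under eq_bigr do rewrite scalerA.
  rewrite -scaler_suml; have /matrixP/(_ j j) := DC; rewrite !mxE eqxx => ->.
  by rewrite scale1r (tnth_nth 0).
under eq_bigr do rewrite scalerA.
rewrite -scaler_suml; have /matrixP/(_ j k) := DC; rewrite !mxE => ->.
by rewrite eq_sym (negPf kj) scale0r.
Qed.

Lemma gram_comb n r (b : r.-tuple V) (C : 'M[F]_(n, r)) :
  basis_of {:V} b ->
  gram B [tuple \sum_k C i k *: b`_k | i < n] = C *m gram B b *m C^T.
Proof.
move=> bP; rewrite (gram_coord B _ bP) /=; set C' := \matrix_(i, k) _.
suff -> : C' = C by [].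
apply/matrixP=> i k; rewrite mxE tnth_mktuple coord_sum_free //.
exact: basis_free bP.
Qed.

Lemma frame_of_gram n (G : 'M[F]_n) r (b : r.-tuple V) (C : 'M[F]_(n, r)) :
  basis_of {:V} b -> \rank G = r -> G = C *m gram B b *m C^T ->
  exists2 phi : n.-tuple V, is_frame phi & G = gram B phi.
Proof.
move=> bP rG GE; exists [tuple \sum_k C i k *: b`_k | i < n].
  (* [G] factors through [C] and has rank [r], so [C] has full column rank. *)
  apply: frame_comb => //; rewrite /row_full eqn_leq rank_leq_col /= -{1}rG GE.
  by rewrite -mulmxA mxrankM_maxl.
by rewrite gram_comb.
Qed.

End GramMatrices.

(** * The criterion and the realization of symmetric matrices *)

Section Realization.
Variables (F : finFieldType) (oddF : odd #|F|).

Lemma sq_coset_eq (a b : F) :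
  sq_coset a = sq_coset b -> exists2 s, s != 0 & a = s ^+ 2 * b.
Proof.
move=> eqab; have: a \in sq_coset a.
  apply/imsetP; exists 1; last by rewrite mulr1.
  by apply/imsetP; exists 1; rewrite ?inE ?oner_neq0 ?expr1n.
rewrite eqab => /imsetP[_ /imsetP[s sP ->] ->]; rewrite inE in sP.
by exists s; rewrite // mulrC.
Qed.

Lemma frame_gramP (V : vectType F) (B : {symmetric V}) n (G : 'M[F]_n)
    (I : {set 'I_n}) :
  nondegenerate B -> basic_index G I ->
  (exists2 phi : n.-tuple V, is_frame phi & G = gram B phi) <->
  [/\ G = G^T, \rank G = \dim {:V}
    & sq_coset (\det (basic_submx G I)) = discr B].
Proof.
move=> nd bI; split=> [[phi frphi GE] | [symG rG dG]].
  rewrite GE in bI *; have bP := frame_basic_subframe nd frphi bI.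
  split; first exact: gram_sym.
    by rewrite -(basic_index_card bI) (size_basis bP).
  by rewrite (discr_basis B bP) gram_basic_subframe.
(* Indexing the basis by [#|I|] gives its Gram matrix the same type as the basic submatrix. *)
have [b bP] : exists b : #|I|.-tuple V, basis_of {:V} b.
  rewrite (basic_index_card bI) rG; exists (vbasis {:V}); exact: vbasisP.
move: dG; rewrite (discr_basis B bP) => /sq_coset_eq[s s0 ds].
have uGb := basic_submx_unit symG bI.
have symGb : basic_submx G I = (basic_submx G I)^T by rewrite trmx_mxsub -symG.
have [P PE] := congruent_of_det oddF symGb (gram_sym B b) uGb
  (gram_unit nd bP) s0 ds.
have [A AE] := sym_basic_factor symG bI.
apply: (frame_of_gram (C := A^T *m P) bP).
  by rewrite (basic_index_card bI).
by rewrite {1}AE PE trmx_mul trmxK !mulmxA.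
Qed.

(** The space is the coordinate space of dimension [#|I|] with the form given by the basic
    submatrix. The standard basis has this Gram matrix, and the columns of [A] in the factorization
    are the coordinates of the frame. *)
Lemma sym_gram_realizable n (G : 'M[F]_n) :
  G = G^T ->
  exists (V : vectType F) (B : {symmetric V}),
     [/\ nondegenerate B, \dim {:V} = \rank G &
         exists2 phi : n.-tuple V, is_frame phi & G = gram B phi].
Proof.
move=> symG; have [I bI] := basic_index_exists G.
have uGb := basic_submx_unit symG bI.
have hermGb : basic_submx G I \is hermitianmx _ false idfun.
  by apply/is_hermitianmxP; rewrite expr0 scale1r map_mx_id // trmx_mxsub -symG.
pose B : {symmetric 'rV[F]_#|I|} := form_of_matrix idfun (HermitianMx hermGb).
have BE u (i : 'I_#|I|) : B u (delta_mx 0 i) = (u *m basic_submx G I) 0 i.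
  rewrite /B /= /form_of_matrix map_mx_id // trmx_delta -colE.
  by rewrite trace_mx11 mxE.
pose b := [tuple delta_mx 0 i : 'rV[F]_#|I| | i < #|I|].
have bE (i : 'I_#|I|) : b`_i = delta_mx 0 i by rewrite -tnth_nth tnth_mktuple.
have bP : basis_of {:'rV[F]_#|I|} b.
  rewrite basisEfree subvf size_tuple dimvf /dim /= mul1n leqnn !andbT.
  apply/(@freeP _ _ _ b)=> c c0 i; move/rowP/(_ i): c0.
  rewrite (_ : \sum_i _ = \row_i c i) ?mxE // [RHS]row_sum_delta.
  by apply: eq_bigr => k _; rewrite bE mxE.
have gramb : gram B b = basic_submx G I.
  by apply/matrixP=> i j; rewrite mxE !tnth_mktuple BE -rowE mxE.
have [A AE] := sym_basic_factor symG bI.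
exists 'rV[F]_#|I|, B; split.
- apply/nondegenerateP=> u Bu0; apply: (can_inj (mulmxK uGb)).
  by rewrite mul0mx; apply/rowP=> i; rewrite -BE Bu0 mxE.
- by rewrite (size_basis bP) (basic_index_card bI).
apply: (frame_of_gram (C := A^T) bP); first by rewrite (basic_index_card bI).
by rewrite gramb trmxK.
Qed.

End Realization.

Theorem theorem3p15 (F : finFieldType) (oddF : odd #|F|) :
  (forall (V : vectType F) (B : {symmetric V}), nondegenerate B ->
   forall (n : nat) (G : 'M[F]_n) (I : {set 'I_n}), basic_index G I ->
     (exists2 phi : n.-tuple V, is_frame phi & G = gram B phi) <->
     [/\ G = G^T, \rank G = \dim {:V}
       & sq_coset (\det (basic_submx G I)) = discr B])
  /\
  (forall (n : nat) (G : 'M[F]_n), G = G^T ->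
   exists (V : vectType F) (B : {symmetric V}),
     [/\ nondegenerate B,
         exists2 phi : n.-tuple V, is_frame phi & G = gram B phi,
         \dim {:V} = \rank G,
         exists I : {set 'I_n}, basic_index G I
       & forall I : {set 'I_n}, basic_index G I ->
           discr B = sq_coset (\det (basic_submx G I))]).
Proof.
split=> [V B nd n G I | n G symG]; first exact: frame_gramP.
have [V [B [nd dimV frG]]] := sym_gram_realizable symG.
exists V, B; split=> //; first exact: basic_index_exists.
(* The criterion applied to the frame already found gives the discriminant for every choice of
   [I]. *)
by move=> I bI; have [_ _ ->] := (frame_gramP oddF nd bI).1 frG.
Qed.
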